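(* Let $\delta>0$. Then there exists $n_0\in\mathbb{N}$ such that for every $n\ge n_0$ and every $(0,n)$-stopping rule with stopping time $\tau$ there exists a distribution $F$ on $\mathbb{R}_+$ such that, when $X_1,\dots,X_n$ are i.i.d.\ draws from $F$, \[ \mathbb{E}[X_\tau]\ \le\ \Big(\frac1e+\delta\Big)\cdot\mathbb{E}[\max\{X_1,\dots,X_n\}]. \]
   Context: Let $k\in\mathbb{N}_0$, $n\in\mathbb{N}$. Random variables $X_1,\dots,X_n$ (values) and $S_1,\dots,S_k$ (samples) are i.i.d.\ according to a distribution $F$ on $\mathbb{R}_+$. A $(k,n)$-stopping rule is a family of functions $r_1,\dots,r_n$ with $r_i:\mathbb{R}_+^{k+i}\to[0,1]$, where $r_i(s_1,\dots,s_k,x_1,\dots,x_i)$ is the probability of stopping at $X_i$ given samples $s$, values $x_1,\dots,x_i$, and not having stopped earlier; the rule does not depend on $F$. Its stopping time $\tau\in\{1,\dots,n\}\cup\{\infty\}$ satisfies $\Pr[\tau=i\mid S=s,X=x]=\prod_{j<i}(1-r_j(s,x_1,\dots,x_j))\cdot r_i(s,x_1,\dots,x_i)$, and $X_\infty:=0$. *)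

(* Defs.v *)
From HB Require Import structures.
From mathcomp Require Import all_boot all_order all_algebra.
From mathcomp Require Import all_classical all_reals all_analysis.

Set Implicit Arguments.
Unset Strict Implicit.
Unset Printing Implicit Defensive.

Import Order.TTheory GRing.Theory Num.Theory.

Local Open Scope classical_set_scope.
Local Open Scope ring_scope.

(* Values and samples are indexed from 0: the index i : 'I_n stands for the
   (i+1)-st value, at which the k samples and i+1 values have been seen.
   The domain R_+^(k + i+1) is encoded by constraining the range only at
   nonnegative arguments; the other arguments are never used, up to a null
   event. No measurability is required, so that measurable rules are a
   particular case. *)
Record stopping_rule (R : realType) (k n : nat) := StoppingRule {
  stop_prob :> forall i : 'I_n, k.-tuple R -> i.+1.-tuple R -> R;
  stop_prob_itv : forall (i : 'I_n) (s : k.-tuple R) (x : i.+1.-tuple R),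
    (forall j, 0 <= tnth s j) -> (forall j, 0 <= tnth x j) ->
    0 <= @stop_prob i s x <= 1
}.

Arguments stop_prob {R k n} r i s x : rename.

(* x_1, ..., x_(i+1) *)
Definition prefix_tuple (T : Type) (n : nat) (x : n.-tuple T) (i : 'I_n) :
    i.+1.-tuple T :=
  [tuple tnth x (widen_ord (ltn_ord i) j) | j < i.+1].

Definition stop_at (R : realType) (k n : nat) (r : stopping_rule R k n)
    (s : k.-tuple R) (x : n.-tuple R) (i : 'I_n) : R :=
  (\prod_(j < n | (j < i)%N) (1 - r j s (prefix_tuple x j)))
  * r i s (prefix_tuple x i).

Definition iid (R : realType) (F : probability R R) (d : measure_display)
    (T : measurableType d) (P : probability T R) (n : nat)
    (X : 'I_n -> {RV P >-> R}) : Prop :=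
  (forall (i : 'I_n) (A : set R), measurable A ->
     distribution P (X i) A = F A) /\
  (forall A : 'I_n -> set R, (forall i, measurable (A i)) ->
     P (\bigcap_(i in [set: 'I_n]) (X i @^-1` A i))
     = (\prod_(i < n) P (X i @^-1` A i))%E).

Definition observed (R : realType) (d : measure_display)
    (T : measurableType d) (P : probability T R) (n : nat)
    (X : 'I_n -> {RV P >-> R}) (w : T) : n.-tuple R :=
  [tuple X i w | i < n].

(* None is the value oo of the stopping time. The second clause says that
   stop_at r S X i is the conditional probability of [tau = i] given (S, X);
   an event determined by (S, X) is the preimage of a measurable set of the
   product space. *)
Definition is_stopping_time (R : realType) (k n : nat)
    (r : stopping_rule R k n) (d : measure_display) (T : measurableType d)
    (P : probability T R) (S : 'I_k -> {RV P >-> R})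
    (X : 'I_n -> {RV P >-> R}) (tau : T -> option 'I_n) : Prop :=
  (forall i : 'I_n, measurable [set w | tau w = Some i]) /\
  (forall (i : 'I_n) (A : set (k.-tuple R * n.-tuple R)), measurable A ->
     let B := [set w | A (observed S w, observed X w)] in
     P ([set w | tau w = Some i] `&` B)
     = (\int[P]_(w in B) (stop_at r (observed S w) (observed X w) i)%:E)%E).

Definition stopped_value (R : realType) (d : measure_display)
    (T : measurableType d) (P : probability T R) (n : nat)
    (X : 'I_n -> {RV P >-> R}) (tau : T -> option 'I_n) (w : T) : R :=
  if tau w is Some i then X i w else 0.

(* The default 0 is harmless as the values are almost surely nonnegative. *)
Definition max_value (R : realType) (d : measure_display)
    (T : measurableType d) (P : probability T R) (n : nat)
    (X : 'I_n -> {RV P >-> R}) (w : T) : R :=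
  \big[Num.max/0]_(i < n) X i w.

Definition on_nonneg (R : realType) (F : probability R R) : Prop :=
  F [set x | 0 <= x] = 1%E.

(* Excludes the laws for which a comparison with a multiple of the expected
   maximum of n >= 1 draws is void: the point mass at 0 (0 <= 0) and the laws
   of infinite mean (right-hand side +oo). For a law on R_+ it amounts to
   0 < E[max(X_1, ..., X_n)] < +oo. *)
Definition positive_finite_mean (R : realType) (F : probability R R) : Prop :=
  (0 < 'E_F[id] < +oo)%E.

(* Main.v *)
Require Import Defs.
From HB Require Import structures.
From mathcomp Require Import all_boot all_order all_algebra.
From mathcomp Require Import all_classical all_reals all_analysis.
From mathcomp Require Import measurable_realfun.
From mathcomp Require Import ring lra zify.

Import Order.TTheory GRing.Theory Num.Theory.

Local Open Scope classical_set_scope.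
Local Open Scope ring_scope.

(* Let F_th be uniform on v_1, ..., v_th, where v_x = M ^ x with M so large that
   only stopping at v_th counts, and give the scale th <= T the prior weight
   1 / th. Stopping after k values at a record v_x pays only if x is the scale,
   which has weight x ^- k.+1, and sum_(x > m) x ^- k.+1 <= m ^- k / k. Hence,
   after k values of maximum v_m, everything scales as m ^- k: the values are
   worth no more to the rule than their relative ranks, and backward induction
   gives the value of the secretary problem, at most n / e + 2. So some scale is
   bad for the given rule. It can be chosen large, making ties at v_th
   unlikely, since the harmonic series diverges. *)

(** * Power sums and the dual of the secretary problem *)

(** Since z^k <= z^j for j < k, the product k z^k (1 - z) is at most (1 - z)(1 + z + ... + z^(k-1))
    = 1 - z^k. *)
Lemma expr_tangent_le1 (R : realDomainType) (z : R) (k : nat) :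
  0 <= z <= 1 -> k%:R * z ^+ k * (1 - z) + z ^+ k <= 1.
Proof.
move=> /andP[z0 z1]; elim: k => [|k IH]; first by rewrite !mul0r add0r.
have zk : z ^+ k.+1 <= 1 by rewrite exprn_ile1.
have := ler_wpM2l z0 IH; rewrite -natr1 exprS in zk *.
nra.
Qed.

(** The discrete form of the integral of x^-(k+1) over x > m. Each term is at most the decrease of
    x^-k / k over one step, by the tangent bound at z = y / (y + 1), and these decreases
    telescope. *)
Lemma sum_invXn_le (R : realFieldType) (m T k : nat) :
  (0 < m)%N -> (0 < k)%N ->
  \sum_(m.+1 <= x < T.+1) (x%:R : R) ^- k.+1 <= m%:R ^- k / k%:R.
Proof.
move=> m0 k0; have kR : 0 < k%:R :> R by rewrite ltr0n.
have step (y : nat) : (0 < y)%N ->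
  (y.+1%:R : R) ^- k.+1 <= y%:R ^- k / k%:R - y.+1%:R ^- k / k%:R.
  move=> y0; have yR : 0 < y%:R :> R by rewrite ltr0n.
  have sR : 0 < y.+1%:R :> R by rewrite ltr0n.
  pose z : R := y%:R / y.+1%:R.
  have z01 : 0 <= z <= 1.
    by rewrite /z divr_ge0 ?(ltW yR) ?(ltW sR)//= ler_pdivrMr// mul1r ler_nat.
  have z1 : 1 - z = y.+1%:R^-1.
    by rewrite /z -natr1; field; rewrite natr1 gt_eqF.
  have := @expr_tangent_le1 R z k z01; rewrite z1 -lerBrDr.
  have zk0 : 0 < y%:R ^- k :> R by rewrite invr_gt0 exprn_gt0.
  rewrite -(ler_pM2l zk0) mulrBr mulr1 /z expr_div_n.
  rewrite -mulrBl ler_pdivlMr// => H.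
  apply: le_trans (le_trans H _); last first.
    by rewrite mulrA mulVf ?mul1r// expf_neq0// gt_eqF.
  rewrite exprS invfM le_eqVlt; apply/orP; left; apply/eqP.
  by field; rewrite !expf_neq0// gt_eqF.
have [Tm|mT] := leqP T m.
  rewrite big_geq//; apply: divr_ge0; rewrite ?ler0n// invr_ge0 exprn_ge0//.
rewrite big_add1/=.
apply: (@le_trans _ _ (\sum_(m <= y < T)
   (- (y.+1%:R ^- k / k%:R) - - (y%:R ^- k / k%:R : R)))).
  rewrite big_nat [leRHS]big_nat; apply: ler_sum => y /andP[my _].
  by rewrite opprK addrC step// (leq_trans m0).
rewrite telescope_sumr 1?ltnW// opprK gerDr oppr_le0.
by apply: divr_ge0; rewrite ?ler0n// invr_ge0 exprn_ge0.
Qed.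

(* The dual of the secretary problem: [b k] bounds, up to the factor [m ^- k],
   the chance to stop at the largest value after [k] values of maximum [m].
   The threshold [s] is about [n / e]. *)
Lemma secretary_potential (R : realType) (n : nat) : (0 < n)%N ->
  exists b : nat -> R,
    [/\ forall k, (k <= n)%N -> 0 <= b k,
        forall k, (0 < k < n)%N ->
          b k.+1 + Num.max 1 (b k.+1) / k%:R <= b k &
        Num.max 1 (b 1%N) <= n%:R / expR 1 + 2].
Proof.
move=> n0; have nR : 0 < n%:R :> R by rewrite ltr0n.
(* The shift by 2 gives n / e < s - 1, hence ln (n / k) <= 1 from k = s - 1 on, while [b 1 = s]
   stays below n / e + 2. *)
pose s := (Num.truncn (n%:R / expR 1 : R)).+2.
have ne0 : 0 <= n%:R / expR 1 :> R by rewrite divr_ge0 ?expR_ge0// ler0n.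
have /andP[sl su] := truncn_itv ne0.
have s1 : n%:R / expR 1 <= s.-1%:R :> R by rewrite ltW.
have s2 : s%:R <= n%:R / expR 1 + 2 :> R.
  by rewrite /s -addn2 natrD lerD2r.
have lnn1 k : (s.-1 <= k)%N -> ln (n%:R / k%:R : R) <= 1.
  move=> sk; have k0 : 0 < k%:R :> R by rewrite ltr0n (leq_trans _ sk).
  rewrite -[leRHS]expRK ler_ln ?posrE ?divr_gt0 ?expR_gt0//.
  rewrite ler_pdivrMr// mulrC -ler_pdivrMr ?expR_gt0//.
  by rewrite (le_trans s1)// ler_nat.
have lnstep k : (1 < k)%N ->
    ln (n%:R / k%:R : R) + k%:R^-1 <= ln (n%:R / k.-1%:R).
  case: k => [//|[//|k]] _ /=.
  have p1 : 0 < k.+1%:R :> R by rewrite ltr0n.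
  have p2 : 0 < k.+2%:R :> R by rewrite ltr0n.
  have : ln (k.+1%:R / k.+2%:R : R) <= - k.+2%:R^-1.
    have -> : k.+1%:R / k.+2%:R = 1 + - k.+2%:R^-1 :> R.
      apply: (mulIf (lt0r_neq0 p2)); rewrite divfK ?gt_eqF// mulrBl mul1r.
      by rewrite mulVf ?gt_eqF// -[k.+2%:R]natr1 addrK.
    by apply: le_ln1Dx; rewrite ltrN2 invf_lt1// ltr1n.
  rewrite !ln_div ?posrE//.
  by move: (ln k.+1%:R) (ln k.+2%:R) (k.+2%:R^-1) => a c d; lra.
(* Where b (k+1) >= 1 the recursion reads b k = (1 + 1/k) b (k+1), solved by s / k. Where b (k+1) <=
   1 it adds 1 / k, and the sum of 1 / j over k <= j < n is at most ln (n / (k - 1)). *)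
exists (fun k => if (k <= s)%N then s%:R / k%:R else ln (n%:R / k.-1%:R)); split.
- move=> k kn; case: leqP => ks; first by rewrite divr_ge0 ?ler0n.
  have k1 : (0 < k.-1)%N by move: ks; rewrite /s; lia.
  by apply: ln_ge0; rewrite ler_pdivlMr ?ltr0n// mul1r ler_nat; lia.
- move=> k /andP[k0 kn]; have kR : 0 < k%:R :> R by rewrite ltr0n.
  have [ks|ks] := leqP k.+1 s.
    rewrite (leq_trans _ ks)// max_r; last first.
      by rewrite ler_pdivlMr ?ltr0n// mul1r ler_nat.
    rewrite le_eqVlt; apply/orP; left; apply/eqP.
    by rewrite -[k.+1%:R]natr1; field; rewrite natr1 !gt_eqF// ltr0n.
  rewrite max_l; last by rewrite lnn1//; lia.
  rewrite div1r (le_trans (lnstep k _))//; first by move: ks; rewrite /s; lia.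
  (* The two formulas meet here: b s = 1 dominates ln (n / (s - 1)). *)
  case: ifP => // ks'; have -> : k = s by lia.
  by rewrite divff ?lnn1// gt_eqF ?ltr0n.
- by rewrite /= divr1 max_r// ler1n.
Qed.

(** * The Bayesian value of a rule under the harmonic prior *)

(* For values uniform on [1..th] and a rule stopping with probability [rho h]
   after the history [h], [win rho th k h / th] is the probability that the first
   values are [h] and that the rule then stops, within [k] steps and at the first
   occurrence of [th], given that it has survived [h]. *)
Fixpoint win {R : realFieldType} (rho : seq nat -> R) (th k : nat)
    (h : seq nat) : R :=
  if k is k'.+1 then
    th%:R ^- size h * rho (rcons h th)
    + \sum_(1 <= x < th) (1 - rho (rcons h x)) * win rho th k' (rcons h x)
  else 0.

Lemma win_ge0 (R : realFieldType) (rho : seq nat -> R) (th k : nat)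
    (h : seq nat) :
  (forall h, 0 <= rho h <= 1) -> 0 <= win rho th k h.
Proof.
move=> rho01; elim: k h => [//|k IH] h /=.
rewrite addr_ge0//.
  by case/andP: (rho01 (rcons h th)) => *; rewrite mulr_ge0.
rewrite sumr_ge0// => x _; rewrite mulr_ge0// subr_ge0.
by case/andP: (rho01 (rcons h x)).
Qed.

Lemma exchange_big_triangle_nat (V : nmodType) (a b : nat)
    (F : nat -> nat -> V) :
  \sum_(a <= i < b) \sum_(a <= j < i) F i j =
  \sum_(a <= j < b) \sum_(j.+1 <= i < b) F i j.
Proof.
elim: b => [|b IH]; first by rewrite !big_geq.
have [ab|ba] := leqP a b; last by rewrite !big_geq.
rewrite big_nat_recr//= IH [RHS]big_nat_recr//=.
rewrite [\sum_(b.+1 <= i < b.+1) _]big_geq// addr0.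
rewrite -big_split/=; apply: eq_big_nat => j /andP[_ jb].
by rewrite big_nat_recr.
Qed.

Section Bayes.
Variables (R : realFieldType) (rho : seq nat -> R) (T : nat).
Hypothesis rho01 : forall h, 0 <= rho h <= 1.

(* The scale [th] has prior weight [1 / th]. *)
Let W (m k : nat) (h : seq nat) : R :=
  \sum_(m.+1 <= th < T.+1) th%:R^-1 * win rho th k h.

(** Condition on the next value [x]. If x <= m, every scale above [m] stays possible. If x > m,
    either [x] is the scale, with prior 1 / x and likelihood x^-(size h), or the scale exceeds [x],
    which becomes the new [m]. *)
Lemma bayes_win_rec (m k : nat) (h : seq nat) :
  W m k.+1 h =
  \sum_(1 <= x < m.+1) (1 - rho (rcons h x)) * W m k (rcons h x) +
  \sum_(m.+1 <= x < T.+1) (rho (rcons h x) * x%:R ^- (size h).+1 +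
                           (1 - rho (rcons h x)) * W x k (rcons h x)).
Proof.
pose A x th : R :=
  th%:R^-1 * ((1 - rho (rcons h x)) * win rho th k (rcons h x)).
transitivity (\sum_(m.+1 <= th < T.+1)
    (rho (rcons h th) * th%:R ^- (size h).+1 +
    (\sum_(1 <= x < m.+1) A x th + \sum_(m.+1 <= x < th) A x th))).
  apply: eq_big_nat => th /andP[mth _] /=.
  rewrite -big_cat_nat//= -mulr_sumr exprS invfM; ring.
rewrite !big_split/= addrCA exchange_big_nat exchange_big_triangle_nat/=.
by congr (_ + (_ + _)); apply: eq_bigr => x _; rewrite mulr_sumr;
  apply: eq_bigr => th _; rewrite mulrCA.
Qed.

Variables (n : nat) (b : nat -> R).
Hypothesis b_ge0 : forall k, (k <= n)%N -> 0 <= b k.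
Hypothesis b_step : forall k, (0 < k < n)%N ->
  b k.+1 + Num.max 1 (b k.+1) / k%:R <= b k.

Let mix_le (p y z M : R) : 0 <= p <= 1 -> y <= M -> z <= M ->
  p * y + (1 - p) * z <= M.
Proof. by nra. Qed.

(** Here [m] plays the maximum of [h], of length l. Each of the [m] non-records pays nothing if
    stopped at and, by induction, at most b (l+1) m^-(l+1) if passed. A record [x] pays at most max
    1 (b (l+1)) x^-(l+1) either way. Summing the records by [sum_invXn_le] gives m^-l times the left
    side of [b_step]. *)
Lemma bayes_win_le (m k : nat) (h : seq nat) :
  (0 < m)%N -> (0 < size h)%N -> (size h + k)%N = n ->
  W m k h <= b (size h) * m%:R ^- size h.
Proof.
elim: k m h => [|k IH] m h m0 h0 hk.
  rewrite /W big1 => [|th _]; last by rewrite /= mulr0.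
  by rewrite mulr_ge0 ?b_ge0 ?invr_ge0 ?exprn_ge0//; lia.
have bS0 : 0 <= b (size h).+1 by apply: b_ge0; lia.
have WS m' x : (0 < m')%N ->
  W m' k (rcons h x) <= b (size h).+1 * m'%:R ^- (size h).+1.
  by move=> m'0; have := IH m' (rcons h x); rewrite size_rcons; apply=> //; lia.
rewrite bayes_win_rec.
apply: (@le_trans _ _
  (\sum_(1 <= x < m.+1) (b (size h).+1 * m%:R ^- (size h).+1) +
   \sum_(m.+1 <= x < T.+1) (Num.max 1 (b (size h).+1) * x%:R ^- (size h).+1))).
  apply: lerD; rewrite big_nat [leRHS]big_nat; apply: ler_sum => x /andP[x1 x2].
    have := WS m x m0; have := rho01 (rcons h x).
    have : 0 <= b (size h).+1 * m%:R ^- (size h).+1.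
      by rewrite mulr_ge0 ?invr_ge0 ?exprn_ge0.
    by move=> w0 p01 /(mix_le _ 0 _ _ p01 w0); rewrite mulr0 add0r.
  have x0 : 0 <= (x%:R : R) ^- (size h).+1 by rewrite invr_ge0 exprn_ge0.
  apply: mix_le; rewrite ?rho01//.
    by rewrite ler_peMl// le_max lexx.
  apply: le_trans (WS x x _) _; first by lia.
  by rewrite ler_wpM2r// le_max lexx orbT.
rewrite sumr_const_nat subn1/= -mulr_sumr.
have mR : m%:R != 0 :> R by rewrite pnatr_eq0 -lt0n.
have -> : (b (size h).+1 * m%:R ^- (size h).+1) *+ m =
          b (size h).+1 * m%:R ^- size h.
  by rewrite -mulr_natr exprS invfM; field; rewrite mR expf_neq0.
apply: le_trans (ler_wpM2r _ (b_step (size h) _)); last 2 first.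
- by rewrite invr_ge0 exprn_ge0.
- by lia.
rewrite [leRHS]mulrDl lerD2l -[leRHS]mulrA [_^-1 * _]mulrC.
by rewrite ler_wpM2l ?sum_invXn_le// le_max ler01.
Qed.

(** The first value is always a record, so [m = 0] is treated apart: the tail bound needs m > 0, and
    the harmonic sum, the total prior mass, remains instead. *)
Lemma bayes_win_nil_le : (0 < n)%N ->
  \sum_(1 <= th < T.+1) th%:R^-1 * win rho th n [::] <=
  Num.max 1 (b 1%N) * \sum_(1 <= x < T.+1) x%:R^-1.
Proof.
move=> n0; have := bayes_win_rec 0 n.-1 [::]; rewrite prednK// /W => ->.
rewrite big_geq// add0r mulr_sumr big_nat [leRHS]big_nat.
apply: ler_sum => x /andP[x0 _]; rewrite -/(W x n.-1 _).
have xV : 0 <= (x%:R : R)^-1 by rewrite invr_ge0.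
apply: mix_le; rewrite ?rho01// ?expr1.
  by rewrite ler_peMl// le_max lexx.
apply: le_trans (bayes_win_le x n.-1 [:: x] _ _ _) _ => //=; first by lia.
by rewrite ler_wpM2r// le_max lexx orbT.
Qed.

End Bayes.

(** * The uniform law on finitely many points *)

(** The parameter is one less than the number of points, so that the total mass is 1 for every
    [t]. *)
Definition uniform_law {R : realType} (v : nat -> R) (t : nat) :
    set R -> \bar R :=
  mscale (t.+1%:R^-1)%:nng (msum (fun k => \d_(v k.+1)) t.+1).

HB.instance Definition _ (R : realType) (v : nat -> R) (t : nat) :=
  Measure.on (uniform_law v t).

Lemma uniform_lawE (R : realType) (v : nat -> R) (t : nat) (A : set R) :
  uniform_law v t A = (t.+1%:R^-1 * \sum_(k < t.+1) (v k.+1 \in A)%:R)%:E.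
Proof.
rewrite /uniform_law /mscale/= /msum EFinM -sumEFin; congr (_ * _)%E.
Qed.

Lemma uniform_law_setT (R : realType) (v : nat -> R) (t : nat) :
  uniform_law v t [set: R] = 1%E.
Proof.
rewrite uniform_lawE; under eq_bigr do rewrite in_setT.
by rewrite sumr_const card_ord mulVf ?pnatr_eq0.
Qed.

HB.instance Definition _ (R : realType) (v : nat -> R) (t : nat) :=
  Measure_isProbability.Build _ _ _ (uniform_law v t) (uniform_law_setT R v t).

Lemma uniform_law_set1 (R : realType) (v : nat -> R) (t x : nat) :
  injective v -> (0 < x <= t.+1)%N ->
  uniform_law v t [set v x] = (t.+1%:R^-1)%:E.
Proof.
move=> vI /andP[x0 xt]; rewrite uniform_lawE.
have xt' : (x.-1 < t.+1)%N by lia.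
rewrite (bigD1 (Ordinal xt'))//= prednK// mem_set// big1 ?addr0 ?mulr1// => k kx.
rewrite memNset// => /vI kx1; move/eqP: kx; apply; apply/val_inj => /=; lia.
Qed.

Lemma uniform_law_support (R : realType) (v : nat -> R) (t : nat) (A : set R) :
  (forall x, (0 < x <= t.+1)%N -> A (v x)) -> uniform_law v t A = 1%E.
Proof.
move=> Av; rewrite uniform_lawE (eq_bigr (fun=> 1)) => [|k _].
  by rewrite sumr_const card_ord mulVf ?pnatr_eq0.
by rewrite mem_set//; apply: Av; exact: ltn_ord.
Qed.

Lemma expectation_uniform_law (R : realType) (v : nat -> R) (t : nat) :
  (forall x, 0 < v x) -> (0 < 'E_(uniform_law v t)[id] < +oo)%E.
Proof.
move=> v0; rewrite unlock.
(* The identity is negative on part of the line. The absolute value, equal to it almost everywhere,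
   lets the integral of a nonnegative function split over the Dirac masses. *)
have aeq : {ae uniform_law v t, forall w : R, setT w -> w%:E = `|w|%:E}.
  exists [set w | w < 0]; split.
  - have -> : [set w : R | w < 0] = `]-oo, 0[%classic.
      by apply/seteqP; split=> w; rewrite /= in_itv.
    exact: measurable_itv.
  - rewrite uniform_lawE big1 ?mulr0// => k _.
    by rewrite memNset//=; apply/negP; rewrite -leNgt ltW.
  - move=> w /= nw; rewrite ltNge; apply/negP => w0; apply: nw => _.
    by rewrite ger0_norm.
have mnorm : measurable_fun [set: R] (fun w : R => `|w|%:E).
  by apply/measurable_EFinP; exact: normr_measurable.
rewrite (ae_eq_integral (fun w : R => `|w|%:E) _ _ _ _ aeq)//.
rewrite ge0_integral_mscale//= ge0_integral_measure_sum//.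
under eq_bigr => k _ do rewrite integral_dirac// diracT mul1e ger0_norm ?ltW//.
rewrite sumEFin -EFinM ltry lte_fin andbT mulr_gt0//.
by rewrite big_ord_recl ltr_wpDr// sumr_ge0// => k _; rewrite ltW.
Qed.

(** * The probability of stopping at the largest value *)

Lemma content_le_sum (d : measure_display) (T : ringOfSetsType d)
    (R : realFieldType) (mu : {content set T -> \bar R}) (I : choiceType)
    (s : seq I) (A : set T) (B : I -> set T) :
  measurable A -> (forall i, measurable (B i)) ->
  (forall w, A w -> exists2 i, i \in s & B i w) ->
  (mu A <= \sum_(i <- s) mu (B i))%E.
Proof.
move=> mA mB AB.
apply: (@le_trans _ _ (mu (\big[setU/set0]_(i <- s) B i))).
  apply: le_measure; rewrite ?inE//; first exact: bigsetU_measurable.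
  by move=> w /AB[i si Biw]; rewrite -bigcup_seq; exists i.
elim: s {AB} => [|i s IH]; first by rewrite !big_nil measure0.
rewrite !big_cons (le_trans (measureU2 _ _ _))//; first exact: bigsetU_measurable.
by rewrite leeD2l.
Qed.

(* The rule read on histories of indices [x] instead of values [v x]; the value
   is junk on histories that are empty or longer than [n]. *)
Definition rule_on {R : realType} {n : nat} (v : nat -> R)
    (r : stopping_rule R 0 n) (h : seq nat) : R :=
  if insub (size h).-1 is Some i then
    r i [tuple] [tuple v (nth 0%N h j) | j < (i : 'I_n).+1]
  else 0.

Lemma rule_onE (R : realType) (n : nat) (v : nat -> R)
    (r : stopping_rule R 0 n) (h : seq nat) (i : 'I_n) :
  size h = i.+1 ->
  rule_on v r h = r i [tuple] [tuple v (nth 0%N h j) | j < i.+1].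
Proof. by move=> hi; rewrite /rule_on hi/= valK. Qed.

Lemma rule_on_itv (R : realType) (n : nat) (v : nat -> R)
    (r : stopping_rule R 0 n) (h : seq nat) :
  (forall x, 0 <= v x) -> 0 <= rule_on v r h <= 1.
Proof.
move=> v0; rewrite /rule_on; case: insubP => [i _ _|_]; last first.
  by rewrite lexx ler01.
by apply: stop_prob_itv => [[]//|j]; rewrite tnth_mktuple.
Qed.

Section Sample.
Context {R : realType} {d : measure_display} {T : measurableType d}.
Context {P : probability T R} {n : nat}.
Variables (r : stopping_rule R 0 n) (S : 'I_0 -> {RV P >-> R}).
Variables (X : 'I_n -> {RV P >-> R}) (tau : T -> option 'I_n).
Variables (F : probability R R) (v : nat -> R) (th : nat).
Hypothesis F_v : forall x, (0 < x <= th)%N -> F [set v x] = (th%:R^-1)%:E.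
Hypothesis X_iid : iid F X.
Hypothesis tau_r : is_stopping_time r S X tau.

Let rho := rule_on v r.

Definition starts_with (h : seq nat) : set T :=
  [set w | forall i : 'I_n, (i < size h)%N -> X i w = v (nth 0%N h i)].

Lemma measurable_X (i : 'I_n) (A : set R) :
  measurable A -> measurable (X i @^-1` A).
Proof. exact: measurable_funPTI. Qed.

Lemma measurable_X_eq (i : 'I_n) (y : R) : measurable [set w | X i w = y].
Proof. exact: (measurable_X i [set y] (measurable_set1 y)). Qed.

Lemma measurable_tau (i : 'I_n) : measurable [set w | tau w = Some i].
Proof. exact: tau_r.1. Qed.

(** Independence is stated for boxes with [n] sides, so the coordinates beyond [h] get the side
    [setT]. *)
Lemma starts_withE (h : seq nat) : starts_with h =
  \bigcap_(i in [set: 'I_n])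
     (X i @^-1` (if (i < size h)%N then [set v (nth 0%N h i)] else setT)).
Proof.
apply/seteqP; split => w /=.
  by move=> hw i _; have := hw i; case: ifP => //= _; apply.
by move=> hw i ih; have := hw i I; rewrite ih.
Qed.

Lemma measurable_starts_with (h : seq nat) : measurable (starts_with h).
Proof.
rewrite starts_withE; apply: fin_bigcap_measurable => [|i _].
  exact: finite_finset.
by apply: measurable_X; case: ifP.
Qed.

Lemma probability_starts_with (h : seq nat) : (size h <= n)%N ->
  all (fun x => 0 < x <= th)%N h ->
  P (starts_with h) = (th%:R ^- size h)%:E.
Proof.
move=> hn /allP hth; rewrite starts_withE X_iid.2; last by move=> i; case: ifP.
transitivity (\prod_(i < n) (if (i < size h)%N then th%:R^-1 : R else 1)%:E)%E.
  apply: eq_bigr => i _; case: ifPn => ih.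
    by rewrite -(F_v (nth 0%N h i)) ?hth ?mem_nth// -(X_iid.1 i).
  by rewrite preimage_setT probability_setT.
rewrite prodEFin -big_mkcond/= (big_ord_narrow hn) prodr_const card_ord.
by rewrite exprVn.
Qed.

Definition survival (h : seq nat) : R :=
  \prod_(0 <= j < size h) (1 - rho (take j.+1 h)).

Lemma survival_rcons (h : seq nat) (x : nat) :
  survival (rcons h x) = survival h * (1 - rho (rcons h x)).
Proof.
rewrite /survival size_rcons big_nat_recr//=.
rewrite [take _ (rcons h x)]take_oversize ?size_rcons//.
congr (_ * _); apply: eq_big_nat => j /andP[_ jh].
by rewrite -cats1 takel_cat.
Qed.

Lemma stop_at_starts_with (h : seq nat) (x : nat) (i : 'I_n) (w : T) :
  size h = i -> starts_with (rcons h x) w ->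
  stop_at r (observed S w) (observed X w) i = survival h * rho (rcons h x).
Proof.
move=> hi hw; rewrite /stop_at (tuple0 (observed S w))/=.
have rhoE (j : 'I_n) : (j <= i)%N ->
    r j [tuple] (prefix_tuple (observed X w) j) = rho (take j.+1 (rcons h x)).
  move=> ji; rewrite /rho (rule_onE _ _ _ _ _ j); last first.
    by rewrite size_takel// size_rcons hi.
  congr (r j _ _); apply: eq_from_tnth => k; rewrite !tnth_mktuple.
  rewrite hw/= ?nth_take// size_rcons hi; have := ltn_ord k; lia.
congr (_ * _).
  rewrite /survival hi big_mkord.
  rewrite (big_ord_narrow (ltnW (ltn_ord i)))/=.
  apply: eq_bigr => j _; rewrite rhoE/=; last exact/ltnW/ltn_ord.
  by rewrite -cats1 takel_cat// hi; exact: ltn_ord.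
by rewrite rhoE// -hi take_oversize ?size_rcons.
Qed.

(** On this event the conditional stopping probability is constant, so its integral is that constant
    times the probability of the history. *)
Lemma probability_stop_starts_with (h : seq nat) (x : nat) (i : 'I_n) :
  size h = i -> all (fun x => 0 < x <= th)%N (rcons h x) ->
  P ([set w | tau w = Some i] `&` starts_with (rcons h x)) =
  (survival h * rho (rcons h x) * th%:R ^- (size h).+1)%:E.
Proof.
move=> hi hth.
(* The definition of a stopping time speaks of preimages of measurable sets of observations; [A] is
   the box whose preimage is the history event. *)
pose A : set (0.-tuple R * n.-tuple R) := \bigcap_(j in [set: 'I_n])
  (((tnth (T:=R))^~ j \o snd) @^-1`
    (if (j < size (rcons h x))%N then [set v (nth 0%N (rcons h x) j)]
     else setT)).
have mA : measurable A.
  apply: fin_bigcap_measurable => [|j _]; first exact: finite_finset.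
  rewrite -[X in measurable X]setTI; apply: measurableT_comp => //.
  - exact: measurable_tnth.
  - by case: ifP.
have -> : starts_with (rcons h x) = [set w | A (observed S w, observed X w)].
  rewrite starts_withE; apply/seteqP; split => w /= hw j _ /=;
    by have := hw j I; rewrite /= tnth_mktuple.
rewrite tau_r.2//.
have -> : [set w | A (observed S w, observed X w)] = starts_with (rcons h x).
  rewrite starts_withE; apply/seteqP; split => w /= hw j _ /=;
    by have := hw j I; rewrite /= tnth_mktuple.
rewrite (eq_integral (cst (survival h * rho (rcons h x))%:E)); last first.
  by move=> w; rewrite inE => /stop_at_starts_with-> .
rewrite integral_cst; last exact: measurable_starts_with.
have hxn : (size (rcons h x) <= n)%N by rewrite size_rcons hi.
by rewrite [RHS]EFinM -(size_rcons h x) -(probability_starts_with _ hxn hth).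
Qed.

(* [v th] is the largest value of the support. *)
Let stop_first_max (h : seq nat) (i : 'I_n) : set T :=
  [set w | tau w = Some i] `&` [set w | X i w = v th] `&` starts_with h `&`
  [set w | forall j : 'I_n, (size h <= j < i)%N ->
     exists2 x, x \in index_iota 1 th & X j w = v x].

Let measurable_stop_first_max (h : seq nat) (i : 'I_n) :
  measurable (stop_first_max h i).
Proof.
apply: measurableI.
  apply: measurableI; last exact: measurable_starts_with.
  by apply: measurableI; [exact: measurable_tau|exact: measurable_X_eq].
pose V : set R := \bigcup_(x in [set x | (0 < x < th)%N]) [set v x].
have mV : measurable V by apply: bigcup_measurable.
have -> : [set w | forall j : 'I_n, (size h <= j < i)%N ->
     exists2 x, x \in index_iota 1 th & X j w = v x] =
  \bigcap_(j in [set: 'I_n])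
    (X j @^-1` (if (size h <= j < i)%N then V else setT)).
  apply/seteqP; split => w /=.
    move=> hw j _; have := hw j; case: ifP => //= _ /(_ isT)[x].
    by rewrite mem_index_iota => x1 xE; exists x.
  move=> hw j ji; have := hw j I; rewrite ji => -[x x1 xE]; exists x => //.
  by rewrite mem_index_iota.
apply: fin_bigcap_measurable => [|j _]; first exact: finite_finset.
by apply: measurable_X; case: ifP.
Qed.

(** The induction follows the recursion of [win]: stopping right after [h] gives its first term, and
    later stops are split by the next value. The factor 1 / th is the one left out of [win]. *)
Lemma probability_stop_first_max (k : nat) (h : seq nat) : (0 < th)%N ->
  (size h + k)%N = n -> all (fun x => 0 < x < th)%N h ->
  (\sum_(i < n | (size h <= i)%N) P (stop_first_max h i) <=
   (survival h * win rho th k h * th%:R^-1)%:E)%E.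
Proof.
move=> th0; elim: k h => [|k IH] h hk hth.
  rewrite big1 => [|i]; first by rewrite /= mulr0 mul0r.
  by have := ltn_ord i; lia.
have hn : (size h < n)%N by lia.
pose i0 := Ordinal hn.
rewrite (bigD1 i0)//= mulrDr mulrDl EFinD; apply: leeD.
  have hth' : all (fun x => 0 < x <= th)%N (rcons h th).
    rewrite all_rcons th0 leqnn/=; apply: sub_all hth => x; lia.
  have /esym E := probability_stop_starts_with h th i0 erefl hth'.
  have -> : survival h * (th%:R ^- size h * rho (rcons h th)) / th%:R =
    survival h * rho (rcons h th) * th%:R ^- (size h).+1.
    by rewrite exprSr invfM; ring.
  rewrite E; apply: le_measure; rewrite ?inE//.
    apply: measurableI; first exact: measurable_tau.
    exact: measurable_starts_with.
  move=> w [[[/= wtau Xw] hw] _]; split => // j; rewrite size_rcons nth_rcons.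
  rewrite ltnS leq_eqVlt => /orP[/eqP jh|jh]; last by rewrite jh hw.
  by rewrite jh ltnn eqxx -Xw; congr (X _ w); apply: val_inj.
(* A later first occurrence forces the value at [i0] to be some [v x] with x < th, which extends the
   history. *)
apply: (@le_trans _ _ (\sum_(1 <= x < th)
    \sum_(i < n | (size (rcons h x) <= i)%N) P (stop_first_max (rcons h x) i))%E).
  under [leRHS]eq_bigr => x _ do rewrite size_rcons.
  rewrite exchange_big/= (eq_bigl (fun i : 'I_n => (size h < i)%N)); last first.
    by move=> i; rewrite ltn_neqAle andbC eq_sym.
  apply: lee_sum => i hi; apply: content_le_sum => //.
  move=> w [[[/= wtau Xw] hw] fw].
  have [|x x1 Xx] := fw i0; first by rewrite leqnn.
  exists x => //; split; first split => //.
    move=> j; rewrite size_rcons nth_rcons.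
    rewrite ltnS leq_eqVlt => /orP[/eqP jh|jh]; last by rewrite jh hw.
    by rewrite jh ltnn eqxx -Xx; congr (X _ w); apply: val_inj.
  by move=> j; rewrite size_rcons => /andP[hj ji]; apply: fw; rewrite ltnW.
rewrite mulr_sumr mulr_suml -sumEFin big_nat [leRHS]big_nat.
apply: lee_sum => x /andP[x1 x2].
apply: le_trans (IH (rcons h x) _ _) _; first by rewrite size_rcons; lia.
  by rewrite all_rcons x1 x2.
by rewrite survival_rcons lee_fin !mulrA.
Qed.

Hypothesis v_ge0 : forall x, 0 <= v x.
Hypothesis v_homo : {homo v : x y / (x <= y)%N >-> x <= y}.

Let V : set R := \bigcup_(x in [set x | (0 < x <= th)%N]) [set v x].

Hypothesis F_V : F V = 1%E.

Let measurable_V : measurable V.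
Proof. by apply: bigcup_measurable. Qed.

(** The values lie in the support only almost surely; the pointwise arguments below are made off
    this null event. *)
Let outside : set T := ~` [set w | forall i, V (X i w)].

Let measurable_outside : measurable outside.
Proof.
apply: measurableC.
have -> : [set w | forall i, V (X i w)] =
  \bigcap_(i in [set: 'I_n]) (X i @^-1` V).
  by apply/seteqP; split => w /= hw i => [_|]; exact: hw.
apply: fin_bigcap_measurable => [|j _]; first exact: finite_finset.
exact: measurable_X.
Qed.

Let probability_outside : P outside = 0.
Proof.
apply/eqP; rewrite eq_le measure_ge0 andbT.
apply: (@le_trans _ _ (\sum_(i <- index_enum 'I_n) P (X i @^-1` (~` V)))%E).
  apply: content_le_sum => // [i|w /= /existsNP[i Vi]].
    by apply: measurable_X; exact: measurableC.
  by exists i => //; rewrite mem_index_enum.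
rewrite big1// => i _; transitivity (F (~` V)).
  by rewrite -(X_iid.1 i)//; exact: measurableC.
by rewrite probability_setC// F_V subee.
Qed.

Let probability_two_max (i j : 'I_n) : (0 < th)%N -> i != j ->
  P ([set w | X i w = v th] `&` [set w | X j w = v th]) = (th%:R ^- 2)%:E.
Proof.
move=> th0 ij.
have -> : [set w | X i w = v th] `&` [set w | X j w = v th] =
  \bigcap_(k in [set: 'I_n])
    (X k @^-1` (if (k == i) || (k == j) then [set v th] else setT)).
  apply/seteqP; split => w /=.
    by move=> [hi hj] k _; case: ifP => // /orP[] /eqP ->.
  by move=> hw; split; [have := hw i I|have := hw j I]; rewrite eqxx ?orbT.
rewrite X_iid.2; last by move=> k; case: ifP.
have Pv k : P (X k @^-1` [set v th]) = (th%:R^-1)%:E.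
  by rewrite -(F_v th) ?th0 ?leqnn// -(X_iid.1 k).
rewrite (bigD1 i)//= eqxx/= (bigD1 j)//=; last by rewrite eq_sym.
rewrite eqxx orbT !Pv big1 ?mule1; last first.
  move=> k /andP[/negbTE-> /negbTE->].
  by rewrite preimage_setT probability_setT.
by rewrite -EFinM -invfM.
Qed.

Let stop_max (i : 'I_n) : set T :=
  [set w | tau w = Some i] `&` [set w | X i w = v th].

Let measurable_stop_max (i : 'I_n) : measurable (stop_max i).
Proof. by apply: measurableI; [exact: measurable_tau|exact: measurable_X_eq]. Qed.

(** [win] counts only first occurrences of [v th]. Any other stop at [v th] requires a second value
    equal to [v th]; each of the at most n^2 ordered pairs has probability th^-2. *)
Lemma probability_stop_max : (0 < th)%N ->
  (\sum_(i < n) P (stop_max i) <=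
   (win rho th n [::] / th%:R + n%:R ^+ 2 / th%:R ^+ 2)%:E)%E.
Proof.
move=> th0.
have bound i : (P (stop_max i) <=
    P (stop_first_max [::] i) + (n%:R / th%:R ^+ 2)%:E)%E.
  pose B j := if j == i then set0 else
    [set w | X i w = v th] `&` [set w | X j w = v th].
  have mB j : measurable (B j).
    rewrite /B; case: ifP => // _.
    by apply: measurableI; exact: measurable_X_eq.
  have mU : measurable (\big[setU/set0]_(j < n) B j) by exact: bigsetU_measurable.
  apply: (@le_trans _ _ (P (stop_first_max [::] i `|`
    \big[setU/set0]_(j < n) B j `|` outside))).
    apply: le_measure; rewrite ?inE//.
      by apply: measurableU => //; apply: measurableU.
    move=> w [/= wtau Xi].
    have [Vw|] := pselect (forall i, V (X i w)); last by right.
    have [[j [ji Xj]]|noj] := pselect (exists j, j != i /\ X j w = v th).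
      left; right; rewrite -bigcup_seq; exists j; first by rewrite /= mem_index_enum.
      by rewrite /B (negbTE ji).
    left; left; split; first by split.
    move=> j /= ji; have [x /andP[x1 x2] Xjx] := Vw j.
    exists x => //; rewrite mem_index_iota x1/= ltn_neqAle x2 andbT.
    apply/eqP => xth; apply: noj; exists j; split; last by rewrite Xjx xth.
    by apply/eqP => jiE; rewrite jiE ltnn in ji.
  have -> : n%:R / th%:R ^+ 2 = \sum_(j < n) (th%:R ^- 2 : R).
    by rewrite sumr_const card_ord mulr_natl.
  apply: le_trans (measureU2 _ _ _) _ => //; first exact: measurableU.
  rewrite -[leRHS]adde0; apply: leeD; last first.
    by have : (P outside <= 0)%E by rewrite probability_outside.
  apply: le_trans (measureU2 _ _ _) _ => //.
  rewrite leeD2l// -sumEFin.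
  apply: (@le_trans _ _ (\sum_(j < n) P (B j))%E).
    apply: content_le_sum => // w; rewrite -bigcup_seq => -[j /= jn Bj].
    by exists j.
  apply: lee_sum => j _; rewrite /B; case: ifPn => ji.
    by rewrite measure0 lee_fin invr_ge0 exprn_ge0.
  by rewrite probability_two_max// eq_sym.
apply: (@le_trans _ _ (\sum_(i < n) (P (stop_first_max [::] i) +
  (n%:R / th%:R ^+ 2)%:E))%E); first by apply: lee_sum => i _.
rewrite big_split/= EFinD; apply: leeD.
  have := probability_stop_first_max n [::] th0 erefl erefl.
  by rewrite /survival big_geq// mul1r.
by rewrite sumEFin sumr_const card_ord lee_fin -[leLHS]mulr_natl mulrA -expr2.
Qed.

(** * Bounds for the two expectations *)

(** This form gives measurability from that of the level sets of [tau]. *)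
Lemma stopped_value_sum (w : T) :
  stopped_value X tau w = \sum_(i < n) X i w * \1_[set w | tau w = Some i] w.
Proof.
rewrite /stopped_value; case E : (tau w) => [i|].
  rewrite (bigD1 i)//= indicE mem_set// mulr1 big1 ?addr0// => j ji.
  rewrite indicE memNset ?mulr0//= => -[]; rewrite E => -[] ij.
  by rewrite ij eqxx in ji.
by rewrite big1// => i _; rewrite indicE memNset ?mulr0//= E.
Qed.

(** Almost surely the rule either stops at [v th] or collects at most [v th.-1]; the value 0 for not
    stopping falls under the second case. *)
Lemma expectation_stopped_value_le : (0 < th)%N ->
  ('E_P[stopped_value X tau] <=
   (v th.-1 + v th * (win rho th n [::] / th%:R + n%:R ^+ 2 / th%:R ^+ 2))%:E)%E.
Proof.
move=> th0; rewrite unlock.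
pose Z := \big[setU/set0]_(i < n) stop_max i.
have mZ : measurable Z by exact: bigsetU_measurable.
have msv : measurable_fun [set: T] (stopped_value X tau).
  rewrite (funext stopped_value_sum); apply: measurable_sum => i.
  apply: measurable_funM; first exact: measurable_funP.
  by apply: measurable_indic; exact: measurable_tau.
(* On [outside] the stopped value may be negative; cutting it there permits comparison of integrals
   of nonnegative functions. *)
pose g w := stopped_value X tau w * \1_(~` outside) w.
have mg : measurable_fun [set: T] g.
  apply: measurable_funM => //; apply: measurable_indic; exact: measurableC.
have gsv : ae_eq P setT (fun w => (stopped_value X tau w)%:E) (fun w => (g w)%:E).
  exists outside; split => //.
  move=> w /= nw; apply: contrapT => /= ow; apply: nw => _.
  by rewrite /g indicE mem_set// mulr1.
rewrite (ae_eq_integral _ _ _ _ _ gsv)//; last 2 first.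
  exact/measurable_EFinP.
  exact/measurable_EFinP.
pose u w := v th.-1 + v th * \1_Z w.
have u1 w : 0 <= v th * \1_Z w by rewrite mulr_ge0.
have mu : measurable_fun [set: T] (fun w => (u w)%:E).
  apply/measurable_EFinP; apply: measurable_funD => //.
  by apply: measurable_funM => //; exact: measurable_indic.
have inside w : (forall i, V (X i w)) -> 0 <= stopped_value X tau w <= u w.
  move=> Vw; rewrite /stopped_value; case E : (tau w) => [i|].
    have [x /= /andP[x1 x2] Xx] := Vw i.
    have Xge0 : 0 <= X i w by rewrite Xx.
    have [xth|xth] := eqVneq x th.
      rewrite Xge0/= /u indicE mem_set ?mulr1 ?Xx ?xth ?lerDr//.
      rewrite /Z -bigcup_seq; exists i; first by rewrite /= mem_index_enum.
      by rewrite /stop_max/= E Xx xth.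
    rewrite Xge0/= (@le_trans _ _ (v th.-1))// ?lerDl// Xx v_homo//.
    by rewrite -ltnS prednK// ltn_neqAle xth.
  by rewrite lexx/= /u addr_ge0.
have g01 w : 0 <= g w <= u w.
  rewrite /g indicE; case: (pselect (forall i, V (X i w))) => Vw.
    by rewrite mem_set ?mulr1 ?inside//= => nw; exact: nw.
  by rewrite memNset ?mulr0 ?lexx ?addr_ge0//; apply.
apply: (@le_trans _ _ (\int[P]_w (u w)%:E)%E).
  apply: ge0_le_integral => //.
  - by move=> w _; rewrite lee_fin; have /andP[] := g01 w.
  - exact/measurable_EFinP.
  - by move=> w _; rewrite lee_fin; have /andP[] := g01 w.
rewrite /u; under eq_integral do rewrite EFinD.
rewrite ge0_integralD//; last 3 first.
- by move=> w _; rewrite lee_fin.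
- by move=> w _; rewrite lee_fin.
- by apply/measurable_EFinP/measurable_funM => //; exact: measurable_indic.
have -> : (\int[P]_w (v th.-1)%:E)%E = (v th.-1)%:E.
  by rewrite -[RHS](expectation_cst P) unlock.
rewrite EFinD leeD2l//.
under eq_integral do rewrite EFinM.
rewrite ge0_integralZl//; last 2 first.
- by apply/measurable_EFinP; exact: measurable_indic.
- by rewrite lee_fin.
rewrite integral_indic// setIT EFinM lee_wpmul2l ?lee_fin//.
apply: le_trans (probability_stop_max th0).
apply: content_le_sum => // w; rewrite /Z -bigcup_seq => -[j /= jn Bj].
by exists j.
Qed.

Lemma measurable_max_value : measurable_fun [set: T] (max_value X).
Proof.
rewrite /max_value; elim: (index_enum _) => [|i s IH].
  by rewrite (_ : (fun _ => _) = cst 0)//; apply/funext => w; rewrite big_nil.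
rewrite (_ : (fun _ => _) = X i \max (fun w => \big[Num.max/0]_(j <- s) X j w)).
  by apply: measurable_maxr => //; exact: measurable_funP.
by apply/funext => w; rewrite big_cons.
Qed.

(** The maximum is at least [v th] once some value equals [v th], which has probability 1 - (1 -
    p)^n >= n p - n^2 p^2 for p = 1 / th. *)
Lemma expectation_max_value_ge : (0 < th)%N ->
  ((v th * (n%:R / th%:R - n%:R ^+ 2 / th%:R ^+ 2))%:E <= 'E_P[max_value X])%E.
Proof.
move=> th0; rewrite unlock.
pose Z := ~` \bigcap_(i in [set: 'I_n]) (X i @^-1` (~` [set v th])).
have mZ' : measurable (\bigcap_(i in [set: 'I_n]) (X i @^-1` (~` [set v th]))).
  apply: fin_bigcap_measurable => [|j _]; first exact: finite_finset.
  by apply: measurable_X; exact: measurableC.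
have mZ : measurable Z by exact: measurableC.
have max_ge0 w : 0 <= max_value X w.
  by rewrite /max_value; elim/big_rec: _ => // i x _ x0; rewrite le_max x0 orbT.
have max_ge (i : 'I_n) w : X i w <= max_value X w.
  by rewrite /max_value (bigD1 i)//= le_max lexx.
apply: (@le_trans _ _ (\int[P]_w (v th * \1_Z w)%:E)%E); last first.
  apply: ge0_le_integral => //.
  - by move=> w _; rewrite lee_fin mulr_ge0.
  - by apply/measurable_EFinP/measurable_funM => //; exact: measurable_indic.
  - by apply/measurable_EFinP; exact: measurable_max_value.
  move=> w _; rewrite lee_fin indicE.
  have [[i Xi]|no] := pselect (exists i, X i w = v th).
    rewrite mem_set ?mulr1 -?Xi//= => /(_ i I); exact.
  by rewrite memNset ?mulr0// => nw; apply: nw => i _ /= Xi; apply: no; exists i.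
under eq_integral do rewrite EFinM.
rewrite ge0_integralZl//; last 2 first.
- by apply/measurable_EFinP; exact: measurable_indic.
- by rewrite lee_fin.
rewrite integral_indic// setIT EFinM lee_wpmul2l ?lee_fin//.
have PZ : P Z = (1 - (1 - th%:R^-1) ^+ n)%:E.
  rewrite probability_setC// X_iid.2; last by move=> i; exact: measurableC.
  transitivity (1 - (\prod_(i < n) (1 - th%:R^-1 : R)%:E))%E; last first.
    by rewrite prodEFin prodr_const card_ord.
  congr (1 - _)%E; apply: eq_bigr => i _.
  transitivity (F (~` [set v th])).
    by rewrite -(X_iid.1 i)//; exact: measurableC.
  by rewrite probability_setC// F_v ?th0/=.
suff : ((n%:R / th%:R - n%:R ^+ 2 / th%:R ^+ 2)%:E <=
        (1 - (1 - th%:R^-1) ^+ n)%:E :> \bar R)%E by rewrite -PZ.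
have p01 : 0 <= (th%:R^-1 : R) <= 1.
  by rewrite invr_ge0 ler0n invf_le1 ?ltr0n// ler1n.
rewrite lee_fin -exprVn; move: (th%:R^-1) p01 => p /andP[p0 p1].
suff : (1 - p) ^+ n <= 1 - n%:R * p + n%:R ^+ 2 * p ^+ 2 by lra.
elim: n => [|m IH]; first by rewrite !expr0 mul0r subr0 expr0n/= mul0r addr0.
rewrite exprSr -natr1; have m0 : 0 <= m%:R :> R by [].
have : (1 - p) ^+ m * (1 - p) <= (1 - m%:R * p + m%:R ^+ 2 * p ^+ 2) * (1 - p).
  by rewrite ler_wpM2r// subr_ge0.
move=> /le_trans; apply.
have : 0 <= m%:R ^+ 2 * p ^+ 3 by rewrite mulr_ge0 ?exprn_ge0.
have : 0 <= m%:R * p ^+ 2 by rewrite mulr_ge0 ?exprn_ge0.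
have : 0 <= p ^+ 2 by rewrite exprn_ge0.
nra.
Qed.

End Sample.

(** * Choice of a bad scale, and conclusion *)

Lemma harmonic_sum_ge (R : realType) (A : R) (L : nat) :
  exists2 T, (L <= T)%N & A <= \sum_(1 <= x < T.+1) x%:R^-1.
Proof.
have Hn : {homo series (@harmonic R) : m n / (m <= n)%N >-> m <= n}.
  by apply: nondecreasing_series => i _ _; rewrite harmonic_ge0.
have /cvgryPge/(_ A)[N _ NA] := nondecreasing_dvgn_lt Hn (@dvg_harmonic R).
exists (maxn N L); first exact: leq_maxr.
by rewrite big_add1/=; apply: NA; exact: leq_maxl.
Qed.

(** Averaging: were all scales in (L, T] good for the rule, its Bayesian value would be at least n
    (1/e + delta/2) (H_T - H_L), with H the harmonic sums. It is at most n (1/e + delta/4) H_T, and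
    the last hypothesis makes H_L too small for both. *)
Lemma exists_hard_scale (R : realType) (delta : R) (n L T : nat)
    (rho : seq nat -> R) :
  0 < delta -> (0 < n)%N -> (L <= T)%N -> 8 / delta <= n%:R ->
  (forall h, 0 <= rho h <= 1) ->
  ((expR 1)^-1 + delta / 2) * \sum_(1 <= x < L.+1) x%:R^-1 <
    delta / 4 * \sum_(1 <= x < T.+1) x%:R^-1 ->
  exists2 th, (L < th <= T)%N &
    win rho th n [::] <= n%:R * ((expR 1)^-1 + delta / 2).
Proof.
move=> d0 n0 LT nd rho01 HLT.
have [b [b0 bS b1]] := secretary_potential R n n0.
have nR : 0 < n%:R :> R by rewrite ltr0n.
have bT := bayes_win_nil_le R rho T rho01 n b b0 bS n0.
apply: contrapT => nth.
have Hge : n%:R * ((expR 1)^-1 + delta / 2) * (\sum_(L.+1 <= x < T.+1) x%:R^-1) <=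
    \sum_(1 <= th < T.+1) th%:R^-1 * win rho th n [::].
  rewrite [leRHS](@big_cat_nat _ _ _ L.+1)//= ler_wpDl//.
    by apply: sumr_ge0 => th _; rewrite mulr_ge0 ?win_ge0.
  rewrite mulr_sumr [leLHS]big_nat [leRHS]big_nat; apply: ler_sum => th /andP[th1 th2].
  rewrite mulrC ler_wpM2l//; apply: contrapT => /negP; rewrite -ltNge => /ltW wth.
  by apply: nth; exists th => //; rewrite th1.
have H0 : 0 <= \sum_(1 <= x < T.+1) x%:R^-1 :> R.
  by apply: sumr_ge0 => x _; rewrite invr_ge0.
(* The excess 2 of the secretary bound is at most n delta / 4, since 8 / delta <= n. *)
have b1' : Num.max 1 (b 1%N) <= n%:R * ((expR 1)^-1 + delta / 4).
  apply: le_trans b1 _; rewrite mulrDr lerD2l.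
  by move: nd; rewrite ler_pdivrMr//; lra.
have := le_trans Hge (le_trans bT (ler_wpM2r H0 b1')).
rewrite -!mulrA ler_pM2l//.
move: HLT; rewrite [in X in _ < X](@big_cat_nat _ _ _ L.+1)//=.
rewrite [in X in _ <= X](@big_cat_nat _ _ _ L.+1)//=.
lra.
Qed.

Theorem theorem2 (R : realType) (delta : R) (delta_gt0 : 0 < delta) :
  exists n0 : nat, forall n : nat, (0 < n)%N -> (n0 <= n)%N ->
  forall r : stopping_rule R 0 n,
  exists F : probability R R,
    on_nonneg F /\ positive_finite_mean F /\
    forall (d : measure_display) (T : measurableType d) (P : probability T R)
      (S : 'I_0 -> {RV P >-> R}) (X : 'I_n -> {RV P >-> R})
      (tau : T -> option 'I_n),
      iid F X -> is_stopping_time r S X tau ->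
      ('E_P[stopped_value X tau]
       <= ((expR 1)^-1 + delta)%:E * 'E_P[max_value X])%E.
Proof.
pose c : R := (expR 1)^-1; have c0 : 0 < c by rewrite invr_gt0 expR_gt0.
exists (Num.truncn (8 / delta)).+1 => n n_gt0 n_big r.
have nR : 0 < n%:R :> R by rewrite ltr0n.
have n8 : 8 / delta <= n%:R.
  by rewrite ltW// (lt_le_trans (truncnS_gt _))// ler_nat.
(* A scale above [K] makes all errors of order 1 / th^2 fit into n (delta / 2) / th: 1 for values
   below the largest, n^2 for ties in the stopped value, (c + delta) n^2 for the loss in the
   maximum. *)
pose K : R := (1 + n%:R ^+ 2 + (c + delta) * n%:R ^+ 2) / (n%:R * (delta / 2)).
(* [T] will satisfy H_T >= A + 1 > A, which is the hypothesis of [exists_hard_scale]. *)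
pose L := (Num.truncn K).+1.
pose A : R := (c + delta / 2) * (\sum_(1 <= x < L.+1) x%:R^-1) / (delta / 4).
have [T LT HT] := harmonic_sum_ge R (A + 1) L.
(* The values must be fixed before the scale, since the rule on histories depends on them. So [M]
   exceeds th^2 for every th <= T, making v (th - 1) at most v th / th^2. *)
pose M : R := (T.+2 ^ 2)%:R; pose v x : R := M ^+ x.
have M1 : 1 < M by rewrite ltr1n; nia.
have v0 x : 0 < v x by rewrite exprn_gt0// (lt_trans ltr01).
have v_homo : {homo v : x y / (x <= y)%N >-> x <= y}.
  by move=> x y xy; rewrite ler_eXn2l.
have v_inj : injective v.
  by move=> x y /eqP; rewrite /v eq_le !ler_eXn2l// -eqn_leq => /eqP.
have [] := exists_hard_scale R delta n L T (rule_on v r) delta_gt0 n_gt0 LT n8.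
- by move=> h; apply: rule_on_itv => x; exact: ltW.
- rewrite -/c [ltRHS]mulrC -ltr_pdivrMr ?divr_gt0//.
  by rewrite (lt_le_trans _ HT)// ltrDl.
move=> [//|t] /andP[Lt tT] Wt.
exists (uniform_law v t); split; [|split].
- by apply: uniform_law_support => x _; exact: ltW.
- exact: expectation_uniform_law.
move=> d Om P S X tau X_iid tau_r.
have F_v x : (0 < x <= t.+1)%N -> uniform_law v t [set v x] = (t.+1%:R^-1)%:E.
  exact: uniform_law_set1.
have v0' x : 0 <= v x by exact: ltW.
have Eup := expectation_stopped_value_le r S X tau (uniform_law v t) v t.+1
  F_v X_iid tau_r v0' v_homo.
have Emax := expectation_max_value_ge X (uniform_law v t) v t.+1 F_v X_iid v0'.
have V1 : uniform_law v t
    (\bigcup_(x in [set x | (0 < x <= t.+1)%N]) [set v x]) = 1%E.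
  by apply: uniform_law_support => x xt; exists x.
apply: le_trans (Eup V1 (ltn0Sn t)) _.
have cd0 : 0 <= c + delta by rewrite addr_ge0 ?ltW.
apply: le_trans (lee_wpmul2l _ (Emax (ltn0Sn t))); last by rewrite lee_fin.
rewrite -EFinM lee_fin -!exprVn.
pose q : R := t.+1%:R^-1; rewrite -/c -/q.
have q0 : 0 < q by rewrite invr_gt0 ltr0n.
have KQ : (1 + n%:R ^+ 2 + (c + delta) * n%:R ^+ 2) * q <= n%:R * (delta / 2).
  have nd0 : 0 < n%:R * (delta / 2) by rewrite mulr_gt0 ?divr_gt0.
  rewrite /q ler_pdivrMr ?ltr0n// -ler_pdivrMl// [leLHS]mulrC -/K.
  by rewrite ltW// (lt_le_trans (truncnS_gt _))// ler_nat ltnW.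
have vt : v t <= v t.+1 * q ^+ 2.
  rewrite [v t.+1]exprSr -mulrA ler_peMr ?v0'//.
  rewrite /q exprVn ler_pdivlMr ?exprn_gt0 ?ltr0n// mul1r -natrX ler_nat.
  by rewrite leq_exp2r// ltnW// ltnW.
have Wq := ler_wpM2r (ltW q0) Wt.
have := ler_wpM2r (ltW q0) KQ.
rewrite -/c in Wq *; move: (win _ _ _ _) Wq => W Wq KQ2.
(* After division by [v t.+1], the claim is the sum of [Wq] and [KQ2]: the two halves of [delta] pay
   for the choice of the scale and for the errors of order q^2. *)
apply: (@le_trans _ _ (v t.+1 * (q ^+ 2 + (W * q + n%:R ^+ 2 * q ^+ 2)))).
  by rewrite [leRHS]mulrDr lerD2r.
by rewrite [leRHS]mulrCA ler_wpM2l ?v0'//; lra.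
Qed.
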